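(* For all rational numbers $u,v$, define $$\begin{aligned} x_1&=-98u^4-1007u^3v+1804u^2v^2+687uv^3+774v^4,\\ x_2&=2u^4+858u^3v-2396u^2v^2-1518uv^3+1314v^4,\\ x_3&=-128u^4+308u^3v+1404u^2v^2+132uv^3+144v^4,\\ x_4&=122u^4+853u^3v-1056u^2v^2-753uv^3-1206v^4,\\ x_5&=102u^4-1012u^3v+244u^2v^2+1452uv^3-1026v^4,\\ y_1&=102u^4+1133u^3v-2096u^2v^2-693uv^3+1314v^4,\\ y_2&=122u^4-642u^3v+1804u^2v^2+1782uv^3-1206v^4,\\ y_3&=-128u^4-572u^3v-56u^2v^2+2772uv^3+144v^4,\\ y_4&=2u^4-407u^3v+1404u^2v^2-2013uv^3-1026v^4,\\ y_5&=-98u^4+488u^3v-1056u^2v^2-1848uv^3+774v^4. \end{aligned}$$ Then $\sum_{i=1}^5x_i=\sum_{i=1}^5y_i=0$ and $$\sum_{i=1}^5x_i^r=\sum_{i=1}^5y_i^r\qquad\text{for } r=1,2,3,4,6.$$ Moreover, as a parametric solution this is nontrivial and nonsymmetric: in $\mathbb{Q}[u,v]$ the multiset $\{y_1,\dots,y_5\}$ is equal neither to the multiset $\{x_1,\dots,x_5\}$ nor to the multiset $\{-x_1,\dots,-x_5\}$.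
   Context: An ideal solution of the Tarry-Escott problem of degree $k$ consists of two distinct multisets $\{x_1,\dots,x_{k+1}\}$, $\{y_1,\dots,y_{k+1}\}$ with $\sum x_i^r=\sum y_i^r$ for $r=1,\dots,k$. For $k=4$, a solution with $\sum x_i=\sum y_i=0$ is symmetric if, after rearrangement, $x_i=-y_i$ for all $i$, and nonsymmetric otherwise. *)

(* Defs.v *)
From mathcomp Require Import all_boot all_order all_algebra.
From mathcomp Require Import mpoly.

Set Implicit Arguments.
Unset Strict Implicit.
Unset Printing Implicit Defensive.

Import GRing.Theory.
Local Open Scope ring_scope.

(* The two families of quartic forms are given over an arbitrary commutative
   ring, so that the same formulas yield both the rational numbers x_i, y_i
   (u, v : rat) and the polynomials x_i, y_i of Q[u,v] (u, v the indeterminates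
   of {mpoly rat[2]}).  Multisets are represented by sequences up to perm_eq. *)

Definition te_x (R : comNzRingType) (u v : R) : 5.-tuple R :=
  [tuple
    - 98 * u ^+ 4 - 1007 * u ^+ 3 * v + 1804 * u ^+ 2 * v ^+ 2
      + 687 * u * v ^+ 3 + 774 * v ^+ 4;
    2 * u ^+ 4 + 858 * u ^+ 3 * v - 2396 * u ^+ 2 * v ^+ 2
      - 1518 * u * v ^+ 3 + 1314 * v ^+ 4;
    - 128 * u ^+ 4 + 308 * u ^+ 3 * v + 1404 * u ^+ 2 * v ^+ 2
      + 132 * u * v ^+ 3 + 144 * v ^+ 4;
    122 * u ^+ 4 + 853 * u ^+ 3 * v - 1056 * u ^+ 2 * v ^+ 2
      - 753 * u * v ^+ 3 - 1206 * v ^+ 4;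
    102 * u ^+ 4 - 1012 * u ^+ 3 * v + 244 * u ^+ 2 * v ^+ 2
      + 1452 * u * v ^+ 3 - 1026 * v ^+ 4].

Definition te_y (R : comNzRingType) (u v : R) : 5.-tuple R :=
  [tuple
    102 * u ^+ 4 + 1133 * u ^+ 3 * v - 2096 * u ^+ 2 * v ^+ 2
      - 693 * u * v ^+ 3 + 1314 * v ^+ 4;
    122 * u ^+ 4 - 642 * u ^+ 3 * v + 1804 * u ^+ 2 * v ^+ 2
      + 1782 * u * v ^+ 3 - 1206 * v ^+ 4;
    - 128 * u ^+ 4 - 572 * u ^+ 3 * v - 56 * u ^+ 2 * v ^+ 2
      + 2772 * u * v ^+ 3 + 144 * v ^+ 4;
    2 * u ^+ 4 - 407 * u ^+ 3 * v + 1404 * u ^+ 2 * v ^+ 2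
      - 2013 * u * v ^+ 3 - 1026 * v ^+ 4;
    - 98 * u ^+ 4 + 488 * u ^+ 3 * v - 1056 * u ^+ 2 * v ^+ 2
      - 1848 * u * v ^+ 3 + 774 * v ^+ 4].

(* Main.v *)
Require Import Defs.
From mathcomp Require Import all_boot all_order all_algebra.
From mathcomp Require Import mpoly ring.

Import GRing.Theory.
Local Open Scope ring_scope.

(** The power-sum identities are polynomial identities, valid over any
    commutative ring.  For the two inequalities of multisets it suffices to
    separate the multisets after a specialisation of (u, v).  The point (2, 1)
    does this; (1, 0), (0, 1) and (1, 1) do not, since the multisets of
    the x_i and the y_i coincide there. *)

Lemma sum_te_x (R : comNzRingType) (u v : R) :
  \sum_(i < 5) tnth (te_x u v) i = 0.
Proof. by rewrite !big_ord_recl big_ord0 !(tnth_nth 0) /=; ring. Qed.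

Lemma sum_te_y (R : comNzRingType) (u v : R) :
  \sum_(i < 5) tnth (te_y u v) i = 0.
Proof. by rewrite !big_ord_recl big_ord0 !(tnth_nth 0) /=; ring. Qed.

Lemma te_power_sums (R : comNzRingType) (u v : R) (r : nat) :
  r \in [:: 1; 2; 3; 4; 6]%N ->
  \sum_(i < 5) tnth (te_x u v) i ^+ r = \sum_(i < 5) tnth (te_y u v) i ^+ r.
Proof.
rewrite !inE !big_ord_recl !big_ord0 !(tnth_nth 0) /=.
by case/or4P => [/eqP->|/eqP->|/eqP->|/orP[]/eqP->]; ring.
Qed.

(** The coefficients are integers, so every ring morphism respects the forms; evaluating them in
    Q[u,v] thus reduces to substituting for [u] and [v]. *)
Lemma map_te_x (R S : comNzRingType) (f : {rmorphism R -> S}) (u v : R) :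
  map f (te_x u v) = te_x (f u) (f v).
Proof.
by rewrite /=; congr [:: _; _; _; _; _]; ring.
Qed.

Lemma map_te_y (R S : comNzRingType) (f : {rmorphism R -> S}) (u v : R) :
  map f (te_y u v) = te_y (f u) (f v).
Proof.
by rewrite /=; congr [:: _; _; _; _; _]; ring.
Qed.

Theorem mainTheorem2 :
  (forall u v : rat,
     [/\ \sum_(i < 5) tnth (te_x u v) i = 0,
         \sum_(i < 5) tnth (te_y u v) i = 0 &
         forall r : nat, r \in [:: 1; 2; 3; 4; 6]%N ->
           \sum_(i < 5) tnth (te_x u v) i ^+ r =
           \sum_(i < 5) tnth (te_y u v) i ^+ r]) /\
  (let u : {mpoly rat[2]} := 'X_(0 : 'I_2) in
   let v : {mpoly rat[2]} := 'X_(1 : 'I_2) in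
   ~ perm_eq (te_y u v) (te_x u v) /\
   ~ perm_eq (te_y u v) [seq - a | a <- te_x u v]).
Proof.
split=> [u v|u v].
  by split; [exact: sum_te_x | exact: sum_te_y | exact: te_power_sums].
pose ev : {rmorphism {mpoly rat[2]} -> rat} :=
  meval (fun i : 'I_2 => if i == 0 then 2 else 1).
have evu : ev u = 2 by exact: mevalXU.
have evv : ev v = 1 by exact: mevalXU.
(* At (2, 1) the second entry of [te_y] is 6390, while [te_x] is -260, -4410, 6440, 1840, -3610:
   this one value rules out both permutations. *)
split=> /(perm_map ev); rewrite map_te_y evu evv.
  by rewrite map_te_x evu evv; apply/negP; vm_compute.
(* [ev] is moved inside the negation, so that it acts on [te_x] itself and [map_te_x] applies. *)
rewrite -map_comp (@eq_map _ _ (ev \o -%R) (-%R \o ev) (rmorphN ev)).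
by rewrite map_comp map_te_x evu evv; apply/negP; vm_compute.
Qed.
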